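(* For $i\in\mathcal S$, let $\boldsymbol{\alpha}_i(t)=(\boldsymbol{\alpha}_i^1(t),\ldots,\boldsymbol{\alpha}_i^{K-1}(t))$, with $\boldsymbol{\alpha}_i^k(t)=(\alpha_{i,1}^k(t),\ldots,\alpha_{i,N_k}^k(t))$, be row vectors of real-valued differentiable functions of $t\ge 0$, and let $u_i(x,t)=\sum_{k=1}^{K-1}\sum_{n=1}^{N_k}\alpha_{i,n}^k(t)\,\phi_n^k(x)$. The discontinuous Galerkin weak formulation (with upwind numerical flux) of the system of partial differential equations $$\frac{\partial}{\partial t}f_i(x,t)=\sum_{j\in\mathcal S}f_j(x,t)T_{ji}-c_i\frac{\partial}{\partial x}f_i(x,t),\qquad i\in\mathcal S,\ x\in[0,\mathcal I],\ t\ge 0,$$ is the system of ordinary differential equations $$\frac{d}{dt}\boldsymbol{\alpha}_i(t)=\sum_{j\in\mathcal S}\boldsymbol{\alpha}_j(t)T_{ji}+c_i\,\boldsymbol{\alpha}_i(t)(G+F_i)M^{-1},\qquad i\in\mathcal S;$$ that is, the family $(u_i)_{i\in\mathcal S}$ satisfies the weak formulation for all $t\ge 0$ if and only if $(\boldsymbol{\alpha}_i)_{i\in\mathcal S}$ satisfies this system of ordinary differential equations for all $t\ge 0$.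
   Context: Setting. $\mathcal S$ is a finite set, $T=(T_{ij})_{i,j\in\mathcal S}$ is the irreducible generator of a continuous-time Markov chain on $\mathcal S$, and $c_i\in\mathbb R$ for $i\in\mathcal S$. Let $K\ge 2$ and $0=x_1<x_2<\cdots<x_K=\mathcal I<\infty$ be nodal points, with meshes $\mathcal D_k=[x_k,x_{k+1}]$, $k=1,\ldots,K-1$. The left and right endpoints of the $k$-th mesh are denoted $x_k^L=x_k$ and $x_k^R=x_{k+1}$. For any function $g$, $[g(x)]_{a}^{b}:=g(b)-g(a)$. Basis functions. For each $k$ there are $N_k$ linearly independent, continuously differentiable basis functions $\phi_n^k:\mathcal D_k\to[0,\infty)$, $n=1,\ldots,N_k$. Each $\phi_n^k$ is regarded as zero outside its own mesh $\mathcal D_k$ (also outside $[0,\mathcal I]$); the values $\phi_n^k(x_k)$, $\phi_n^k(x_{k+1})$ are its values at the endpoints of $\mathcal D_k$. Write $\boldsymbol{\phi}^k(x)=(\phi_1^k(x),\ldots,\phi_{N_k}^k(x))$ (a row vector), and $N=\sum_{k=1}^{K-1}N_k$. One-sided limits are $g(x^+)=\lim_{\varepsilon\downarrow 0}g(x+\varepsilon)$ and $g(x^-)=\lim_{\varepsilon\downarrow 0}g(x-\varepsilon)$. Matrices $M$ and $G$. These are the $N\times N$ block-diagonal matrices $M=\mathrm{diag}(M^1,\ldots,M^{K-1})$ and $G=\mathrm{diag}(G^1,\ldots,G^{K-1})$ with $$[M^k]_{mn}=\int_{\mathcal D_k}\phi_m^k(x)\phi_n^k(x)\,dx,\qquad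 [G^k]_{mn}=\int_{\mathcal D_k}\phi_m^k(x)\,\frac{d}{dx}\phi_n^k(x)\,dx,\qquad m,n\in\{1,\ldots,N_k\}.$$ Ratios. For $\ell\in\{k-1,k+1\}$ with $1\le \ell\le K-1$, $$\eta_{\ell,k}:=\frac{\int_{\mathcal D_k}\phi_m^k(x)\,dx}{\int_{\mathcal D_\ell}\phi_n^\ell(x)\,dx},$$ where it is assumed that the basis functions are such that this ratio is well defined and does not depend on the choice of $m\in\{1,\ldots,N_k\}$ and $n\in\{1,\ldots,N_\ell\}$. Upwind numerical flux. For the $k$-th mesh, $f_i^*$ is defined at the two endpoints of the mesh as follows. If $c_i>0$: $f_i^*(x_k^R,t):=u_i(x_{k+1}^-,t)$, and $f_i^*(x_k^L,t):=\eta_{k-1,k}\,u_i(x_k^-,t)$ for $k\ge 2$, while for $k=1$, $f_i^*(x_1^L,t):=u_i(x_1^-,t)=0$. If $c_i<0$: $f_i^*(x_k^L,t):=u_i(x_k^+,t)$, and $f_i^*(x_k^R,t):=\eta_{k+1,k}\,u_i(x_{k+1}^+,t)$ for $k\le K-2$, while for $k=K-1$, $f_i^*(x_{K-1}^R,t):=u_i(x_K^+,t)=0$. Flux matrix. $F_i$ is the $N\times N$ block matrix with blocks $F_i^{\ell k}$ of size $N_\ell\times N_k$, $\ell,k\in\{1,\ldots,K-1\}$, given as follows. If $c_i>0$: $F_i^{k-1,k}:=\eta_{k-1,k}\,[\boldsymbol{\phi}^{k-1}(x_k^-)]^{\top}\boldsymbol{\phi}^k(x_k)$ for $k=2,\ldots,K-1$;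 $F_i^{kk}:=-[\boldsymbol{\phi}^k(x_{k+1}^-)]^{\top}\boldsymbol{\phi}^k(x_{k+1})$ for $k=1,\ldots,K-1$; all other blocks are $0$. If $c_i<0$: $F_i^{k+1,k}:=-\eta_{k+1,k}\,[\boldsymbol{\phi}^{k+1}(x_{k+1}^+)]^{\top}\boldsymbol{\phi}^k(x_{k+1})$ for $k=1,\ldots,K-2$; $F_i^{kk}:=[\boldsymbol{\phi}^k(x_k^+)]^{\top}\boldsymbol{\phi}^k(x_k)$ for $k=1,\ldots,K-1$; all other blocks are $0$. If $c_i=0$, all terms multiplied by $c_i$ (those involving $F_i$ or $f_i^*$) are taken to be $0$. Weak formulation. Write $u_i^k(x,t)=\sum_{n=1}^{N_k}\alpha_{i,n}^k(t)\phi_n^k(x)$ for the part of $u_i$ on the mesh $\mathcal D_k$. The discontinuous Galerkin weak formulation is obtained by replacing $f_i$ by $u_i$ in the partial differential equations, multiplying by a basis function $\phi_m^k$, integrating over $\mathcal D_k$, integrating the spatial derivative term by parts, and replacing $u_i^k$ in the resulting boundary term by the numerical flux $f_i^*$. Explicitly, $(u_i)_{i\in\mathcal S}$ satisfies the weak formulation if, for all $i\in\mathcal S$, $t\ge 0$, $k\in\{1,\ldots,K-1\}$ and $m\in\{1,\ldots,N_k\}$, $$\int_{\mathcal D_k}\Big[\frac{\partial}{\partial t}u_i^k(x,t)-\sum_{j\in\mathcal S}u_j^k(x,t)T_{ji}\Big]\phi_m^k(x)\,dx+c_i\big[f_i^*(x,t)\phi_m^k(x)\big]_{x_k^L}^{x_k^R}-\int_{\mathcal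 D_k}c_i\,u_i^k(x,t)\,\frac{d}{dx}\phi_m^k(x)\,dx=0.$$ *)

(* Defs.v *)
From HB Require Import structures.
From mathcomp Require Import all_boot all_order all_algebra.
From mathcomp Require Import all_classical all_reals all_analysis.

Set Implicit Arguments.
Unset Strict Implicit.
Unset Printing Implicit Defensive.

Import Order.TTheory GRing.Theory Num.Theory.
Import numFieldNormedType.Exports.

Local Open Scope classical_set_scope.
Local Open Scope ring_scope.

(* Derivative of f : D -> R, with difference quotients taken inside D only.  It
   is one-sided at the endpoints of a closed interval D, and is used both for
   the basis functions on their mesh and for functions of the time t >= 0. *)
Definition quotient_within (R : realType) (f : R -> R) (a : R) : R -> R :=
  fun y => (f y - f a) / (y - a).

Definition derivable_within (R : realType) (D : set R) (f : R -> R) (a : R) :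
    Prop :=
  cvg (quotient_within f a y @[y --> within D (a^')]).

Definition derive_within (R : realType) (D : set R) (f : R -> R) (a : R) : R :=
  lim (quotient_within f a y @[y --> within D (a^')]).

Definition C1_on (R : realType) (D : set R) (f : R -> R) : Prop :=
  (forall y, D y -> derivable_within D f y) /\
  {within D, continuous (derive_within D f)}.

Definition lin_indep_on (R : realType) (D : set R) (n : nat)
    (f : 'I_n -> R -> R) : Prop :=
  forall a : 'I_n -> R,
    (forall y, D y -> \sum_(i < n) a i * f i y = 0) -> forall i, a i = 0.

Definition time (R : realType) : set R := [set` `[0, +oo[%R].

Definition generator (R : realType) (S : finType) (T : S -> S -> R) : Prop :=
  (forall i j, i != j -> 0 <= T i j) /\ (forall i, \sum_(j : S) T i j = 0).

Definition irreducible (R : realType) (S : finType) (T : S -> S -> R) : Prop :=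
  forall i j, connect (fun a b => (a != b) && (0 < T a b)) i j.

(* Nodes and meshes are numbered from 0: the K nodes are x 0 < ... < x K.-1
   (later values of x are irrelevant), and the K.-1 meshes are
   mesh x k = [x k, x k.+1] for k < K.-1. *)
Definition mesh (R : realType) (x : nat -> R) (k : nat) : set R :=
  `[x k, x k.+1]%classic.

Definition mesh_int (R : realType) (x : nat -> R) (k : nat) (f : R -> R) : R :=
  \int[lebesgue_measure]_(y in mesh x k) f y.

Definition Mblock (R : realType) (K : nat) (x : nat -> R) (N : 'I_K.-1 -> nat)
    (phi : forall k : 'I_K.-1, 'I_(N k) -> R -> R) (k : 'I_K.-1) : 'M[R]_(N k) :=
  \matrix_(m, n) mesh_int x k (fun y => phi k m y * phi k n y).

Definition Gblock (R : realType) (K : nat) (x : nat -> R) (N : 'I_K.-1 -> nat)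
    (phi : forall k : 'I_K.-1, 'I_(N k) -> R -> R) (k : 'I_K.-1) : 'M[R]_(N k) :=
  \matrix_(m, n)
    mesh_int x k (fun y => phi k m y * derive_within (mesh x k) (phi k n) y).

Definition Mmx (R : realType) (K : nat) (x : nat -> R) (N : 'I_K.-1 -> nat)
    (phi : forall k : 'I_K.-1, 'I_(N k) -> R -> R) : 'M[R]_(\sum_(k < K.-1) N k) :=
  \mxdiag_(k < K.-1) Mblock x phi k.

Definition Gmx (R : realType) (K : nat) (x : nat -> R) (N : 'I_K.-1 -> nat)
    (phi : forall k : 'I_K.-1, 'I_(N k) -> R -> R) : 'M[R]_(\sum_(k < K.-1) N k) :=
  \mxdiag_(k < K.-1) Gblock x phi k.

(* eta is the family of ratios eta l k = \int phi^k_m / \int phi^l_n for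
   neighbouring meshes l and k; that such a family exists is the assumption that
   the ratios are well defined and do not depend on m and n. *)
Definition is_eta (R : realType) (K : nat) (x : nat -> R) (N : 'I_K.-1 -> nat)
    (phi : forall k : 'I_K.-1, 'I_(N k) -> R -> R) (eta : nat -> nat -> R) :
    Prop :=
  forall l k : 'I_K.-1, l.+1 = k \/ k.+1 = l ->
  forall (m : 'I_(N k)) (n : 'I_(N l)),
    mesh_int x l (phi l n) != 0 /\
    eta l k = mesh_int x k (phi k m) / mesh_int x l (phi l n).

Definition phi_at (R : realType) (n : nat) (f : 'I_n -> R -> R) (a : R) :
    'rV[R]_n := \row_(j < n) f j a.
Definition phi_left (R : realType) (n : nat) (f : 'I_n -> R -> R) (a : R) :
    'rV[R]_n := \row_(j < n) lim (f j y @[y --> a^'-]).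
Definition phi_right (R : realType) (n : nat) (f : 'I_n -> R -> R) (a : R) :
    'rV[R]_n := \row_(j < n) lim (f j y @[y --> a^'+]).

(* The blocks F^{l k} of the flux matrix for a positive, resp. negative, speed. *)
Definition Fblock_pos (R : realType) (K : nat) (x : nat -> R)
    (N : 'I_K.-1 -> nat) (phi : forall k : 'I_K.-1, 'I_(N k) -> R -> R)
    (eta : nat -> nat -> R) (l k : 'I_K.-1) : 'M[R]_(N l, N k) :=
  if l.+1 == k :> nat then
    eta l k *: ((phi_left (phi l) (x k))^T *m phi_at (phi k) (x k))
  else if l == k then
    - ((phi_left (phi l) (x k.+1))^T *m phi_at (phi k) (x k.+1))
  else 0.

Definition Fblock_neg (R : realType) (K : nat) (x : nat -> R)
    (N : 'I_K.-1 -> nat) (phi : forall k : 'I_K.-1, 'I_(N k) -> R -> R)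
    (eta : nat -> nat -> R) (l k : 'I_K.-1) : 'M[R]_(N l, N k) :=
  if k.+1 == l :> nat then
    - (eta l k *: ((phi_right (phi l) (x k.+1))^T *m phi_at (phi k) (x k.+1)))
  else if l == k then
    (phi_right (phi l) (x k))^T *m phi_at (phi k) (x k)
  else 0.

Definition Fmx (R : realType) (K : nat) (x : nat -> R) (N : 'I_K.-1 -> nat)
    (phi : forall k : 'I_K.-1, 'I_(N k) -> R -> R) (eta : nat -> nat -> R)
    (ci : R) : 'M[R]_(\sum_(k < K.-1) N k) :=
  if 0 < ci then \mxblock_(l < K.-1, k < K.-1) Fblock_pos x phi eta l k
  else if ci < 0 then \mxblock_(l < K.-1, k < K.-1) Fblock_neg x phi eta l k
  else 0.

Definition u_mesh (R : realType) (S : finType) (K : nat) (N : 'I_K.-1 -> nat)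
    (phi : forall k : 'I_K.-1, 'I_(N k) -> R -> R)
    (alpha : S -> forall k : 'I_K.-1, 'I_(N k) -> R -> R)
    (i : S) (k : 'I_K.-1) (y t : R) : R :=
  \sum_(n < N k) alpha i k n t * phi k n y.

Definition u_sol (R : realType) (S : finType) (K : nat) (N : 'I_K.-1 -> nat)
    (phi : forall k : 'I_K.-1, 'I_(N k) -> R -> R)
    (alpha : S -> forall k : 'I_K.-1, 'I_(N k) -> R -> R) (i : S) (y t : R) : R :=
  \sum_(k < K.-1) u_mesh phi alpha i k y t.

(* Upwind fluxes at the left and right endpoints of mesh k, for a speed ci and
   a function v = u_i(., t).  At the boundary nodes x 0 (ci > 0) and x K.-1
   (ci < 0) the flux is the plain one-sided limit from outside, which is 0 for
   v supported in [x 0, x K.-1]. *)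
Definition flux_left (R : realType) (x : nat -> R) (eta : nat -> nat -> R)
    (ci : R) (v : R -> R) (k : nat) : R :=
  if 0 < ci then
    if k == 0%N then lim (v y @[y --> (x k)^'-])
    else eta k.-1 k * lim (v y @[y --> (x k)^'-])
  else if ci < 0 then lim (v y @[y --> (x k)^'+])
  else 0.

Definition flux_right (R : realType) (K : nat) (x : nat -> R)
    (eta : nat -> nat -> R) (ci : R) (v : R -> R) (k : nat) : R :=
  if 0 < ci then lim (v y @[y --> (x k.+1)^'-])
  else if ci < 0 then
    if k.+1 == K.-1 then lim (v y @[y --> (x k.+1)^'+])
    else eta k.+1 k * lim (v y @[y --> (x k.+1)^'+])
  else 0.

Definition weak_formulation (R : realType) (S : finType) (T : S -> S -> R)
    (c : S -> R) (K : nat) (x : nat -> R) (N : 'I_K.-1 -> nat)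
    (phi : forall k : 'I_K.-1, 'I_(N k) -> R -> R) (eta : nat -> nat -> R)
    (alpha : S -> forall k : 'I_K.-1, 'I_(N k) -> R -> R) : Prop :=
  forall (i : S) (t : R), 0 <= t -> forall (k : 'I_K.-1) (m : 'I_(N k)),
    let u j y s := u_sol phi alpha j y s in
    let uk j y s := u_mesh phi alpha j k y s in
    mesh_int x k (fun y =>
        (derive_within (@time R) (uk i y) t - \sum_(j : S) uk j y t * T j i)
        * phi k m y)
    + c i * (flux_right K x eta (c i) (u i ^~ t) k * phi k m (x k.+1)
             - flux_left x eta (c i) (u i ^~ t) k * phi k m (x k))
    - mesh_int x k (fun y =>
        c i * uk i y t * derive_within (mesh x k) (phi k m) y)
    = 0.

Definition coef_row (R : realType) (K : nat) (N : 'I_K.-1 -> nat)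
    (a : forall k : 'I_K.-1, 'I_(N k) -> R) : 'rV[R]_(\sum_(k < K.-1) N k) :=
  \mxrow_(k < K.-1) \row_(n < N k) a k n.

Definition ode_system (R : realType) (S : finType) (T : S -> S -> R)
    (c : S -> R) (K : nat) (x : nat -> R) (N : 'I_K.-1 -> nat)
    (phi : forall k : 'I_K.-1, 'I_(N k) -> R -> R) (eta : nat -> nat -> R)
    (alpha : S -> forall k : 'I_K.-1, 'I_(N k) -> R -> R) : Prop :=
  forall (i : S) (t : R), 0 <= t ->
    coef_row (fun k n => derive_within (@time R) (alpha i k n) t) =
    \sum_(j : S) T j i *: coef_row (fun k n => alpha j k n t)
    + c i *: (coef_row (fun k n => alpha i k n t)
              *m (Gmx x phi + Fmx x phi eta (c i)) *m invmx (Mmx x phi)).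

(* Main.v *)
Require Import Defs.
From HB Require Import structures.
From mathcomp Require Import all_boot all_order all_algebra.
From mathcomp Require Import all_classical all_reals all_analysis.

Set Implicit Arguments.
Unset Strict Implicit.
Unset Printing Implicit Defensive.

Import Order.TTheory GRing.Theory Num.Theory.
Import numFieldNormedType.Exports.

Local Open Scope classical_set_scope.
Local Open Scope ring_scope.

(** Fix a species i, a time t, a mesh k and a basis function phi_m of that mesh.
    The left-hand side of the weak formulation is linear in the coefficients of
    the expansion of u, so every integral in it is a combination of entries of
    M or G, and every flux value is a combination of one-sided limits of the
    basis functions at a node.  It is therefore a coordinate of a row vector,
    the [residual]
        (alpha_i' - sum_j T_ji alpha_j) M - c_i alpha_i (G + F_i),
    and the weak formulation says that this vector vanishes ([weak_lhsE],
    [weak_formulation_residual]).  Since M is invertible, this is the system of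
    ordinary differential equations.

    Three facts make this work.
    - The time derivative acts on the coefficients only
      ([derive_within_lincomb]), and continuity of the basis functions and of
      their derivatives on the compact meshes makes all integrals linear
      ([mesh_int_lincomb]).
    - A basis function is supported in its own mesh, so its limit from the left
      at a node is zero unless the node is the right end of that mesh, and its
      limit from the right is zero unless the node is the left end
      ([cvg_left_node], [cvg_right_node]).  Hence the upwind flux at a node sees
      a single mesh, and that is the pattern of nonzero blocks of F_i
      ([coef_row_Fmx]); at the two ends of the domain the incoming flux is zero
      because no mesh lies outside.
    - M is block diagonal with Gram matrices of linearly independent continuous
      functions as blocks.  If v is in the kernel of a block, the function
      g = sum_n v_n phi_n is orthogonal to every phi_n, so the integral of g ^ 2
      is zero, so g = 0 on the mesh and v = 0 ([gram_unitmx]). *)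

(** * Derivatives relative to a set *)

Lemma within_dnbhs_cvg (R : realType) (D : set R) (f : R -> R) (a : R) :
  f y @[y --> within D (a^')] --> f a -> f y @[y --> within D (nbhs a)] --> f a.
Proof.
move=> cf P Pfa; move: (cf P Pfa); rewrite /= !nbhs_simpl/=.
rewrite /within/= /dnbhs /within/= => H.
near=> y => Dy; have [->|ya] := eqVneq y a; first exact: nbhs_singleton Pfa.
by move: ya Dy; near: y.
Unshelve. all: by end_near. Qed.

(** With q the difference quotient, f y = f a + q y * (y - a) and q has a limit
    at a. *)
Lemma derivable_within_cvg (R : realType) (D : set R) (f : R -> R) (a : R) :
  derivable_within D f a -> f y @[y --> within D (nbhs a)] --> f a.
Proof.
move=> df; apply: within_dnbhs_cvg.
have FF : Filter (within D a^') by exact: within_filter.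
have ca : (y - a) @[y --> within D a^'] --> a - a.
  apply: cvgB; last exact: cvg_cst.
  by apply: cvg_trans (@nbhs_dnbhs _ a); exact: cvg_within.
have := cvgM df ca; rewrite subrr mulr0 => /(_ FF) q0.
have := cvgD (@cvg_cst _ (f a) _ (within D a^') FF) q0.
rewrite addr0 => /(_ FF) q1.
apply: (cvg_trans _ q1); apply: near_eq_cvg.
rewrite near_withinE /dnbhs near_withinE; apply: nearW => y ya _ /=.
rewrite -[LHS]/(f a + (f y - f a) / (y - a) * (y - a)).
by rewrite divfK ?subr_eq0// addrC subrK.
Qed.

Lemma C1_on_continuous (R : realType) (D : set R) (f : R -> R) :
  C1_on D f -> {within D, continuous f}.
Proof.
move=> [df _]; apply/subspace_continuousP => y Dy.
exact/derivable_within_cvg/df.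
Qed.

(** Limits are unique only along a proper filter; the times just after t show
    that this one is, also at t = 0. *)
Lemma within_time_proper (R : realType) (t : R) :
  0 <= t -> ProperFilter (within (@time R) t^').
Proof.
move=> t0; split; last exact: within_filter.
rewrite /within/= => H.
suff : \forall y \near t^'+, False by move/filter_ex => [].
rewrite near_withinE; move: H; rewrite /dnbhs near_withinE; apply: filterS => y.
move=> + ty; apply; first by rewrite gt_eqF.
by rewrite /time/= in_itv/= andbT (le_trans t0)// ltW.
Qed.

Lemma cvg_sum (R : realType) (U : Type) (F : set_system U) (I : finType)
    (f : I -> U -> R) (l : I -> R) :
  Filter F -> (forall i, f i y @[y --> F] --> l i) ->
  \sum_i f i y @[y --> F] --> \sum_i l i.
Proof. by move=> FF fl; apply: cvg_big => //; exact: add_continuous. Qed.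

Lemma derive_within_lincomb (R : realType) (n : nat) (f : 'I_n -> R -> R)
    (a : 'I_n -> R) (t : R) :
  0 <= t -> (forall i, derivable_within (@time R) (f i) t) ->
  derive_within (@time R) (fun s => \sum_(i < n) f i s * a i) t =
  \sum_(i < n) derive_within (@time R) (f i) t * a i.
Proof.
move=> t0 df; have FF := within_time_proper t0.
apply: cvg_lim => //.
have H : \sum_(i < n) (quotient_within (f i) t y * a i)
             @[y --> within (@time R) t^'] -->
    \sum_(i < n) derive_within (@time R) (f i) t * a i.
  apply: cvg_sum => i; apply: cvgMl.
  exact: df.
apply: (cvg_trans _ H); apply: near_eq_cvg; apply: nearW => y.
rewrite /quotient_within -sumrB mulr_suml; apply: eq_bigr => i _.
by rewrite -mulrBl mulrAC.
Qed.

(** * Integrals of continuous functions on a mesh *)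

Lemma within_continuous_lincomb (R : realType) (D : set R) (n : nat)
    (f : 'I_n -> R -> R) (a : 'I_n -> R) :
  (forall i, {within D, continuous (f i)}) ->
  {within D, continuous (fun y => \sum_(i < n) a i * f i y)}.
Proof.
move=> cf y; apply: cvg_sum => i; apply: cvgMr; exact: cf.
Qed.

Lemma within_continuousM (R : realType) (D : set R) (f g : R -> R) :
  {within D, continuous f} -> {within D, continuous g} ->
  {within D, continuous (fun y => f y * g y)}.
Proof. by move=> cf cg y; apply: cvgM; [exact: cf|exact: cg]. Qed.

Lemma mesh_int_lincomb (R : realType) (x : nat -> R) (k n : nat)
    (f : 'I_n -> R -> R) (a : 'I_n -> R) :
  (forall i, {within mesh x k, continuous (f i)}) ->
  mesh_int x k (fun y => \sum_(i < n) a i * f i y) =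
  \sum_(i < n) a i * mesh_int x k (f i).
Proof.
move=> cf.
have mD : measurable (mesh x k) by exact: measurable_itv.
have intf i : lebesgue_measure.-integrable (mesh x k) (EFin \o f i).
  by apply: continuous_compact_integrable; [exact: segment_compact|exact: cf].
have intaf i : lebesgue_measure.-integrable (mesh x k)
    (EFin \o (fun y => a i * f i y)).
  apply: continuous_compact_integrable; first exact: segment_compact.
  by move=> y; apply: cvgMr; exact: cf.
rewrite /mesh_int /Rintegral.
under eq_integral do rewrite -sumEFin.
rewrite integral_sum// -sum_fine; last first.
  by move=> i _; apply: integrable_fin_num (intaf i).
by apply: eq_bigr => i _; exact: RintegralZl.
Qed.

(** The function vanishes outside a null set A.  An interior point where it is
    nonzero would have a whole ball of such points, of positive measure, inside
    A; the end points follow by continuity. *)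
Lemma continuous_int_eq0 (R : realType) (a b : R) (f : R -> R) : a < b ->
  {within `[a, b], continuous f} -> (forall y, `[a, b]%classic y -> 0 <= f y) ->
  \int[lebesgue_measure]_(y in `[a, b]) f y = 0 ->
  forall y, `[a, b]%classic y -> f y = 0.
Proof.
move=> ab cf f0 int0.
have mD : measurable (`[a, b]%classic : set R) by exact: measurable_itv.
have intf : lebesgue_measure.-integrable `[a, b]%classic (EFin \o f).
  by apply: continuous_compact_integrable; [exact: segment_compact|exact: cf].
have [H _] := ae_eq_integral_abs lebesgue_measure mD (measurable_int _ intf).
have H' : ae_eq lebesgue_measure `[a, b]%classic (EFin \o f) (cst 0%E).
  apply: H; transitivity (\int[lebesgue_measure]_(y in `[a, b]) (f y)%:E)%E.
    by apply: eq_integral => y; rewrite inE => /f0 fy; rewrite gee0_abs.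
  rewrite -(fineK (integrable_fin_num _ intf))//; congr (_%:E); exact: int0.
case: H' => A [mA A0 HA].
have inner y : y \in `]a, b[ -> f y = 0.
  move=> yab; apply/eqP/negPn/negP => fy0.
  have cfy : {for y, continuous f}.
    exact: within_continuous_continuous ab cf yab.
  have near_f : \forall z \near y, f z != 0.
    by apply: (cvgr_neq0 _ cfy fy0).
  have : \forall z \near y, A z.
    near=> z; apply: HA => /= Hz.
    have fz : f z != 0 by near: z.
    have : EFin (f z) = 0%E.
      apply: Hz; rewrite /= in_itv/=.
      have : z \in `]a, b[ by near: z; exact: near_in_itvoo.
      by rewrite in_itv/= => /andP[/ltW-> /ltW->].
    by move=> [] fz0; rewrite fz0 eqxx in fz.
  move=> /nbhs_ballP[e /= e0]; rewrite ball_itv => eA.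
  have : lebesgue_measure (`]y - e, y + e[%classic : set R) = 0%E.
    by apply: (subset_measure0 _ mA eA A0); exact: measurable_itv.
  rewrite lebesgue_measure_itv/= lte_fin ltrBlDr -addrA ltrDl addr_gt0//.
  rewrite -EFinB => -[] /eqP; rewrite opprB addrC addrA subrK.
  by rewrite gt_eqF// addr_gt0.
have [_ fa fb] := (continuous_within_itvP f ab).1 cf.
move=> y; rewrite /= in_itv/= => /andP[]; rewrite le_eqVlt => /predU1P[<- _|ay].
  apply: (cvg_unique _ fa) => //; apply: cvg_near_cst; near=> z; apply: inner.
  by rewrite in_itv/=; apply/andP; split; near: z;
    [exact: nbhs_right_gt|exact: nbhs_right_lt].
rewrite le_eqVlt => /predU1P[->|yb].
  apply: (cvg_unique _ fb) => //; apply: cvg_near_cst; near=> z; apply: inner.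
  by rewrite in_itv/=; apply/andP; split; near: z;
    [exact: nbhs_left_gt|exact: nbhs_left_lt].
by apply: inner; rewrite in_itv/= ay yb.
Unshelve. all: by end_near. Qed.

Lemma mesh_int_lincombM (R : realType) (x : nat -> R) (k n : nat)
    (f : 'I_n -> R -> R) (g : R -> R) (a : 'I_n -> R) :
  (forall i, {within mesh x k, continuous (f i)}) ->
  {within mesh x k, continuous g} ->
  mesh_int x k (fun y => (\sum_(i < n) a i * f i y) * g y) =
  \sum_(i < n) a i * mesh_int x k (fun y => f i y * g y).
Proof.
move=> cf cg.
rewrite -(@mesh_int_lincomb _ x k n (fun i y => f i y * g y)); last first.
  by move=> i; exact: within_continuousM.
congr (mesh_int x k _); apply: funext => y.
by rewrite mulr_suml; apply: eq_bigr => i _; rewrite mulrA.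
Qed.

(** * Invertibility of the mass matrix *)

(** A kernel vector v gives g = sum_i v_i f_i orthogonal to every f_j, so the
    integral of g ^ 2 is zero; being continuous, g vanishes identically. *)
Lemma gram_unitmx (R : realType) (x : nat -> R) (k n : nat)
    (f : 'I_n -> R -> R) :
  x k < x k.+1 -> (forall i, {within mesh x k, continuous (f i)}) ->
  lin_indep_on (mesh x k) f ->
  (\matrix_(i, j) mesh_int x k (fun y => f i y * f j y)) \in unitmx.
Proof.
move=> xk cf indep; rewrite -row_free_unit; apply: inj_row_free => v vA0.
pose g y := \sum_(i < n) v 0 i * f i y.
have cg : {within mesh x k, continuous g} by exact: within_continuous_lincomb.
have g_orth j : mesh_int x k (fun y => f j y * g y) = 0.
  have /rowP/(_ j) := vA0; rewrite !mxE => <-.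
  under [RHS]eq_bigr do rewrite mxE.
  rewrite -mesh_int_lincombM//; congr mesh_int; apply: funext => y.
  exact: mulrC.
have g0 y : mesh x k y -> g y * g y = 0.
  apply: (@continuous_int_eq0 _ _ _ (fun z => g z * g z) xk) => //.
  - exact: within_continuousM.
  - by move=> z _; rewrite -expr2 sqr_ge0.
  - rewrite -[LHS]/(mesh_int x k (fun y => g y * g y)) mesh_int_lincombM//.
    by rewrite big1// => j _; rewrite g_orth mulr0.
apply/rowP => i; rewrite mxE; apply: indep => y /g0/eqP.
by rewrite mulf_eq0 orbb => /eqP.
Qed.

Lemma unitmx_mxdiag (F : fieldType) (p : nat) (N : 'I_p -> nat)
    (B : forall k, 'M[F]_(N k)) :
  (forall k, B k \in unitmx) -> \mxdiag_k B k \in unitmx.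
Proof.
move=> uB; rewrite -row_free_unit; apply: inj_row_free => v.
rewrite -[v]submxrowK mul_mxrow_mxdiag -(@mxrow0 F p N 1) => /eq_mxrowP vB0.
apply/eq_mxrowP => k.
by rewrite -[submxrow v k](mulmxK (uB k)) vB0 mul0mx.
Qed.

(** * One-sided limits at the nodes *)

Lemma cvg_left_support (R : realType) (a b p : R) (f : R -> R) :
  (forall y, ~ `[a, b]%classic y -> f y = 0) -> p <= a \/ b < p ->
  f y @[y --> p^'-] --> 0.
Proof.
move=> f0 H; apply: cvg_near_cst; case: H => [pa|bp]; near=> y;
  apply: f0; rewrite /= in_itv/=;
  apply/negP; rewrite negb_and -!ltNge.
- apply/orP; left; apply: lt_le_trans pa; near: y; exact: nbhs_left_lt.
- by apply/orP; right; near: y; exact: nbhs_left_gt.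
Unshelve. all: by end_near. Qed.

Lemma cvg_right_support (R : realType) (a b p : R) (f : R -> R) :
  (forall y, ~ `[a, b]%classic y -> f y = 0) -> p < a \/ b <= p ->
  f y @[y --> p^'+] --> 0.
Proof.
move=> f0 H; apply: cvg_near_cst; case: H => [pa|bp]; near=> y;
  apply: f0; rewrite /= in_itv/=;
  apply/negP; rewrite negb_and -!ltNge.
- by apply/orP; left; near: y; exact: nbhs_right_lt.
- apply/orP; right; apply: (le_lt_trans bp); near: y; exact: nbhs_right_gt.
Unshelve. all: by end_near. Qed.

Lemma node_lt (R : realType) (K : nat) (x : nat -> R) :
  (forall k : 'I_K.-1, x k < x k.+1) ->
  forall i j, (i < j <= K.-1)%N -> x i < x j.
Proof.
move=> xlt i; elim=> [|j IH] /andP[//].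
rewrite ltnS leq_eqVlt => /predU1P[->|ij] jK; first exact: (xlt (Ordinal jK)).
by rewrite (lt_trans _ (xlt (Ordinal jK)))// IH// ij ltnW.
Qed.

Lemma node_le (R : realType) (K : nat) (x : nat -> R) :
  (forall k : 'I_K.-1, x k < x k.+1) ->
  forall i j, (i <= j <= K.-1)%N -> x i <= x j.
Proof.
move=> xlt i j /andP[]; rewrite leq_eqVlt => /predU1P[->//|ij jK].
by rewrite ltW// (node_lt xlt)// ij.
Qed.

Lemma cvg_left_node (R : realType) (K : nat) (x : nat -> R) (f : R -> R)
    (k : 'I_K.-1) (j : nat) :
  (forall k : 'I_K.-1, x k < x k.+1) ->
  (forall y, ~ mesh x k y -> f y = 0) -> {within mesh x k, continuous f} ->
  (j <= K.-1)%N ->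
  f y @[y --> (x j)^'-] --> (if k.+1 == j then f (x j) else 0).
Proof.
move=> xlt f0 cf jK; have [kj|kj] := eqVneq k.+1 j.
  by rewrite -kj; case: ((continuous_within_itvP f (xlt k)).1 cf).
apply: (cvg_left_support f0); move: kj; rewrite neq_ltn => /orP[kj|jk].
- by right; rewrite (node_lt xlt)// kj.
- by left; rewrite (node_le xlt)// -ltnS jk ltnW.
Qed.

Lemma cvg_right_node (R : realType) (K : nat) (x : nat -> R) (f : R -> R)
    (k : 'I_K.-1) (j : nat) :
  (forall k : 'I_K.-1, x k < x k.+1) ->
  (forall y, ~ mesh x k y -> f y = 0) -> {within mesh x k, continuous f} ->
  (j <= K.-1)%N ->
  f y @[y --> (x j)^'+] --> (if k == j :> nat then f (x j) else 0).
Proof.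
move=> xlt f0 cf jK; have [kj|kj] := eqVneq (k : nat) j.
  by rewrite -kj; case: ((continuous_within_itvP f (xlt k)).1 cf).
apply: (cvg_right_support f0); move: kj; rewrite neq_ltn => /orP[kj|jk].
- by right; rewrite (node_le xlt)// kj.
- by left; rewrite (node_lt xlt)// jk ltnW.
Qed.

(** * The upwind flux as a matrix product *)

Section Flux.
Variables (R : realType) (K : nat) (x : nat -> R) (N : 'I_K.-1 -> nat).
Variables (phi : forall k : 'I_K.-1, 'I_(N k) -> R -> R).
Variable eta : nat -> nat -> R.
Arguments phi : clear implicits.
Hypothesis x_incr : forall k : 'I_K.-1, x k < x k.+1.
Hypothesis phi_out : forall (k : 'I_K.-1) n y, ~ mesh x k y -> phi k n y = 0.
Hypothesis phi_cont : forall (k : 'I_K.-1) n,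
  {within mesh x k, continuous (phi k n)}.
Variable a : forall k : 'I_K.-1, 'I_(N k) -> R.

Arguments a : clear implicits.

Let v y := \sum_(l < K.-1) \sum_(n < N l) a l n * phi l n y.
(* Contributions of mesh l to the left and to the right limit of v at node j. *)
Let trL (l : 'I_K.-1) j := \sum_(n < N l) a l n * (phi_left (phi l) (x j)) 0 n.
Let trR (l : 'I_K.-1) j := \sum_(n < N l) a l n * (phi_right (phi l) (x j)) 0 n.

Lemma lim_left_node j : (j <= K.-1)%N ->
  lim (v y @[y --> (x j)^'-]) = \sum_(l < K.-1) trL l j.
Proof.
move=> jK; apply: cvg_lim => //; apply: cvg_sum => l; apply: cvg_sum => n.
apply: cvgMr; rewrite mxE; apply: (cvgP _ (cvg_left_node x_incr _ _ jK)).
- exact: phi_out.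
- exact: phi_cont.
Qed.

Lemma lim_right_node j : (j <= K.-1)%N ->
  lim (v y @[y --> (x j)^'+]) = \sum_(l < K.-1) trR l j.
Proof.
move=> jK; apply: cvg_lim => //; apply: cvg_sum => l; apply: cvg_sum => n.
apply: cvgMr; rewrite mxE; apply: (cvgP _ (cvg_right_node x_incr _ _ jK)).
- exact: phi_out.
- exact: phi_cont.
Qed.

Lemma trL_eq0 (l : 'I_K.-1) j : (j <= K.-1)%N -> l.+1 != j -> trL l j = 0.
Proof.
move=> jK lj; rewrite /trL big1// => n _; rewrite mxE.
have := cvg_left_node x_incr (@phi_out l n) (@phi_cont l n) jK.
by rewrite (negbTE lj) => /cvg_lim ->//; rewrite mulr0.
Qed.

Lemma trR_eq0 (l : 'I_K.-1) j : (j <= K.-1)%N -> l != j :> nat -> trR l j = 0.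
Proof.
move=> jK lj; rewrite /trR big1// => n _; rewrite mxE.
have := cvg_right_node x_incr (@phi_out l n) (@phi_cont l n) jK.
by rewrite (negbTE lj) => /cvg_lim ->//; rewrite mulr0.
Qed.

(** Both fluxes are written as sums over all meshes l, so that the identity
    holds term by term.  For the left flux this absorbs the case k = 0: no l has
    l.+1 = 0, so the sum is zero, like the limit from outside the domain. *)
Lemma Fblock_pos_row (k : 'I_K.-1) (m : 'I_(N k)) (ci : R) : 0 < ci ->
  \sum_(l < K.-1) ((\row_n a l n) *m Fblock_pos x phi eta l k) 0 m =
  - (flux_right K x eta ci v k * phi k m (x k.+1)
     - flux_left x eta ci v k * phi k m (x k)).
Proof.
move=> ci0.
have rowE (l : 'I_K.-1) (j j' : nat) :
    ((\row_n a l n)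
      *m ((phi_left (phi l) (x j))^T *m phi_at (phi k) (x j'))) 0 m
    = trL l j * phi k m (x j').
  rewrite mulmxA [LHS]mxE big_ord1 [phi_at _ _ _ _]mxE; congr (_ * _).
  by rewrite mxE; apply: eq_bigr => n _; rewrite !mxE.
have -> : flux_right K x eta ci v k =
    \sum_(l < K.-1) (if l == k then trL l k.+1 else 0).
  rewrite /flux_right ci0 lim_left_node//; apply: eq_bigr => l _.
  by case: eqVneq => // lk; rewrite trL_eq0.
have -> : flux_left x eta ci v k =
    \sum_(l < K.-1) (if l.+1 == k :> nat then eta l k * trL l k else 0).
  rewrite /flux_left ci0 lim_left_node; last exact: ltnW.
  case: eqVneq => k0.
    apply: eq_bigr => l _; rewrite trL_eq0 ?mulr0 ?if_same ?k0//.
  rewrite mulr_sumr; apply: eq_bigr => l _.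
  by case: eqVneq => [<-//|lk]; rewrite trL_eq0 ?mulr0// ltnW.
rewrite opprB !mulr_suml -sumrB; apply: eq_bigr => l _.
rewrite /Fblock_pos; case: eqVneq => lk.
  have /negbTE -> : l != k by rewrite -val_eqE/= -lk ltn_eqF.
  by rewrite -scalemxAr [LHS]mxE rowE mul0r subr0 mulrA.
case: eqVneq => [_|_]; first by rewrite mulmxN [LHS]mxE rowE mul0r sub0r.
by rewrite mulmx0 mxE !mul0r subr0.
Qed.

(** The mirror image of the previous lemma: it is now the right flux of the last
    mesh whose sum is zero, since no mesh has the index K.-1. *)
Lemma Fblock_neg_row (k : 'I_K.-1) (m : 'I_(N k)) (ci : R) : ci < 0 ->
  \sum_(l < K.-1) ((\row_n a l n) *m Fblock_neg x phi eta l k) 0 m =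
  - (flux_right K x eta ci v k * phi k m (x k.+1)
     - flux_left x eta ci v k * phi k m (x k)).
Proof.
move=> ci0; have ci0' : (0 < ci) = false by rewrite ltNge ltW.
have rowE (l : 'I_K.-1) (j j' : nat) :
    ((\row_n a l n)
      *m ((phi_right (phi l) (x j))^T *m phi_at (phi k) (x j'))) 0 m
    = trR l j * phi k m (x j').
  rewrite mulmxA [LHS]mxE big_ord1 [phi_at _ _ _ _]mxE; congr (_ * _).
  by rewrite mxE; apply: eq_bigr => n _; rewrite !mxE.
have -> : flux_left x eta ci v k =
    \sum_(l < K.-1) (if l == k then trR l k else 0).
  rewrite /flux_left ci0' ci0 lim_right_node; last exact: ltnW.
  apply: eq_bigr => l _.
  by case: eqVneq => // lk; rewrite trR_eq0// ltnW.
have -> : flux_right K x eta ci v k =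
    \sum_(l < K.-1) (if k.+1 == l :> nat then eta l k * trR l k.+1 else 0).
  rewrite /flux_right ci0' ci0 lim_right_node//.
  case: eqVneq => k0.
    by apply: eq_bigr => l _; rewrite trR_eq0 ?mulr0 ?if_same// k0 ltn_eqF.
  rewrite mulr_sumr; apply: eq_bigr => l _.
  by case: eqVneq => [<-//|lk]; rewrite trR_eq0 ?mulr0// eq_sym.
rewrite opprB !mulr_suml -sumrB; apply: eq_bigr => l _.
rewrite /Fblock_neg; case: eqVneq => lk.
  have /negbTE -> : l != k by rewrite -val_eqE/= -lk gtn_eqF.
  by rewrite mulmxN -scalemxAr -scaleNr [LHS]mxE rowE mul0r sub0r mulNr mulrA.
case: eqVneq => [_|_]; first by rewrite rowE mul0r subr0.
by rewrite mulmx0 mxE !mul0r subr0.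
Qed.

End Flux.

(** * The weak formulation in matrix form *)

Section WeakFormulation.
Variables (R : realType) (K : nat) (x : nat -> R) (N : 'I_K.-1 -> nat).
Variables (phi : forall k : 'I_K.-1, 'I_(N k) -> R -> R).
Variable eta : nat -> nat -> R.
Arguments phi : clear implicits.
Hypothesis x_incr : forall k : 'I_K.-1, x k < x k.+1.
Hypothesis phi_out : forall (k : 'I_K.-1) n y, ~ mesh x k y -> phi k n y = 0.
Hypothesis phi_C1 : forall (k : 'I_K.-1) n, C1_on (mesh x k) (phi k n).

Lemma coef_row_Mmx (a : forall k : 'I_K.-1, 'I_(N k) -> R)
    (k : 'I_K.-1) (m : 'I_(N k)) :
  submxrow (coef_row a *m Mmx x phi) k 0 m =
  mesh_int x k (fun y => (\sum_(n < N k) a k n * phi k n y) * phi k m y).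
Proof.
rewrite mul_mxrow_mxdiag mxrowK mxE mesh_int_lincombM.
- by apply: eq_bigr => n _; rewrite !mxE.
- by move=> n; exact: C1_on_continuous.
- exact: C1_on_continuous.
Qed.

Lemma coef_row_Gmx (a : forall k : 'I_K.-1, 'I_(N k) -> R)
    (k : 'I_K.-1) (m : 'I_(N k)) :
  submxrow (coef_row a *m Gmx x phi) k 0 m =
  mesh_int x k (fun y => (\sum_(n < N k) a k n * phi k n y)
                         * derive_within (mesh x k) (phi k m) y).
Proof.
rewrite mul_mxrow_mxdiag mxrowK mxE mesh_int_lincombM.
- by apply: eq_bigr => n _; rewrite !mxE.
- by move=> n; exact: C1_on_continuous.
- by case: (phi_C1 m).
Qed.

(** Integration by parts gives the boundary term and the volume term opposite
    signs; F carries the boundary term with a minus sign, so that it adds up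
    with G. *)
Lemma coef_row_Fmx (a : forall k : 'I_K.-1, 'I_(N k) -> R) (ci : R)
    (k : 'I_K.-1) (m : 'I_(N k)) :
  let v y := \sum_(l < K.-1) \sum_(n < N l) a l n * phi l n y in
  submxrow (coef_row a *m Fmx x phi eta ci) k 0 m =
  - (flux_right K x eta ci v k * phi k m (x k.+1)
     - flux_left x eta ci v k * phi k m (x k)).
Proof.
move=> v; have cphi (l : 'I_K.-1) n : {within mesh x l, continuous (phi l n)}.
  exact: C1_on_continuous.
rewrite /Fmx; have [ci0|ci0|<-] := ltgtP 0 ci.
- rewrite mul_mxrow_mxblock mxrowK summxE.
  exact: (Fblock_pos_row eta x_incr phi_out cphi a m ci0).
- rewrite mul_mxrow_mxblock mxrowK summxE.
  exact: (Fblock_neg_row eta x_incr phi_out cphi a m ci0).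
- rewrite mulmx0 submxrow0 mxE /flux_right /flux_left !ltxx.
  by rewrite !mul0r subrr oppr0.
Qed.

Lemma Mmx_unit : (forall k : 'I_K.-1, lin_indep_on (mesh x k) (phi k)) ->
  Mmx x phi \in unitmx.
Proof.
move=> phi_indep; apply: unitmx_mxdiag => k; apply: gram_unitmx => //.
by move=> n; exact: C1_on_continuous.
Qed.

Lemma coef_rowB (a b : forall k : 'I_K.-1, 'I_(N k) -> R) :
  coef_row (fun k n => a k n - b k n) = coef_row a - coef_row b.
Proof.
by rewrite -mxrowB; apply: eq_mxrow => k; apply/rowP => n; rewrite !mxE.
Qed.

Lemma coef_rowZ (a : forall k : 'I_K.-1, 'I_(N k) -> R) (z : R) :
  coef_row (fun k n => z * a k n) = z *: coef_row a.
Proof.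
rewrite -mul_scalar_mx mul_mxrow; apply: eq_mxrow => k.
by rewrite mul_scalar_mx; apply/rowP => n; rewrite !mxE.
Qed.

Lemma submxrowZ (z : R) (A : 'rV[R]_(\sum_(k < K.-1) N k)) (k : 'I_K.-1) :
  submxrow (z *: A) k = z *: submxrow A k.
Proof. by rewrite -!mul_scalar_mx mul_submxrow. Qed.

Lemma coef_row_sum (J : finType) (a : J -> forall k : 'I_K.-1, 'I_(N k) -> R) :
  coef_row (fun k n => \sum_j a j k n) = \sum_j coef_row (a j).
Proof.
rewrite -mxrow_sum; apply: eq_mxrow => k; apply/rowP => n.
by rewrite summxE !mxE; apply: eq_bigr => j _; rewrite mxE.
Qed.

Variables (S : finType) (T : S -> S -> R) (c : S -> R).
Variable alpha : S -> forall k : 'I_K.-1, 'I_(N k) -> R -> R.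
Hypothesis alpha_diff : forall i k n (t : R), 0 <= t ->
  derivable_within (@time R) (@alpha i k n) t.

Definition weak_lhs (i : S) (t : R) (k : 'I_K.-1) (m : 'I_(N k)) : R :=
    let u j y s := u_sol phi alpha j y s in
    let uk j y s := u_mesh phi alpha j k y s in
    mesh_int x k (fun y =>
        (derive_within (@time R) (uk i y) t - \sum_(j : S) uk j y t * T j i)
        * phi k m y)
    + c i * (flux_right K x eta (c i) (u i ^~ t) k * phi k m (x k.+1)
             - flux_left x eta (c i) (u i ^~ t) k * phi k m (x k))
    - mesh_int x k (fun y =>
        c i * uk i y t * derive_within (mesh x k) (phi k m) y).

(** The defect of the system of ordinary differential equations, multiplied by
    M so that no inverse occurs. *)
Definition residual (i : S) (t : R) : 'rV[R]_(\sum_(k < K.-1) N k) :=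
  (coef_row (fun k n => derive_within (@time R) (@alpha i k n) t)
   - \sum_(j : S) T j i *: coef_row (fun k n => @alpha j k n t)) *m Mmx x phi
  - c i *: (coef_row (fun k n => @alpha i k n t)
            *m (Gmx x phi + Fmx x phi eta (c i))).

(** Testing against the m-th basis function of mesh k reads off one coordinate
    of the residual. *)
Lemma weak_lhsE i t k m : 0 <= t ->
  @weak_lhs i t k m = submxrow (residual i t) k 0 m.
Proof.
move=> t0; pose a j (k : 'I_K.-1) (n : 'I_(N k)) := @alpha j k n t.
have -> : residual i t =
    coef_row (fun k n => derive_within (@time R) (@alpha i k n) t
                         - \sum_j T j i * a j k n) *m Mmx x phi
    - coef_row (fun k n => c i * a i k n) *m Gmx x phi
    - c i *: (coef_row (a i) *m Fmx x phi eta (c i)).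
  rewrite coef_rowB (@coef_row_sum _ (fun j k n => T j i * a j k n)) coef_rowZ.
  have -> : \sum_j coef_row (fun k n => T j i * a j k n) =
      \sum_j T j i *: coef_row (a j).
    by apply: eq_bigr => j _; exact: coef_rowZ.
  by rewrite /residual mulmxDr scalerDr opprD addrA -scalemxAl.
rewrite !submxrowB submxrowZ.
have entryE (A B C : 'rV[R]_(N k)) (z : R) :
    (A - B - z *: C) 0 m = A 0 m - B 0 m - z * C 0 m by rewrite !mxE.
rewrite entryE coef_row_Mmx coef_row_Gmx coef_row_Fmx mulrN opprK addrAC.
congr (_ + _ - _).
- congr mesh_int; apply: funext => y; congr (_ * _).
  rewrite derive_within_lincomb//; last by move=> n; exact: alpha_diff.
  under [X in _ - X]eq_bigr do rewrite mulr_suml.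
  rewrite exchange_big/= -sumrB; apply: eq_bigr => n _.
  rewrite mulrBl mulr_suml; congr (_ - _); apply: eq_bigr => j _.
  by rewrite mulrAC; congr (_ * _); exact: mulrC.
- congr mesh_int; apply: funext => y; congr (_ * _).
  by rewrite mulr_sumr; apply: eq_bigr => n _; rewrite mulrA.
Qed.

Lemma weak_formulation_residual :
  weak_formulation T c x phi eta alpha <->
  (forall i t, 0 <= t -> residual i t = 0).
Proof.
split=> [weak i t t0|res0 i t t0 k m].
  apply/mxrowP => k; rewrite submxrow0; apply/rowP => m.
  by rewrite -weak_lhsE// mxE; exact: weak.
by have := weak_lhsE i m t0; rewrite res0// submxrow0 mxE.
Qed.

End WeakFormulation.

Theorem theorem3p2 (R : realType) (S : finType) (T : S -> S -> R) (c : S -> R)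
    (K : nat) (x : nat -> R) (N : 'I_K.-1 -> nat)
    (phi : forall k : 'I_K.-1, 'I_(N k) -> R -> R) (eta : nat -> nat -> R)
    (alpha : S -> forall k : 'I_K.-1, 'I_(N k) -> R -> R)
    (T_generator : generator T) (T_irreducible : irreducible T)
    (K_ge2 : (2 <= K)%N) (x_0 : x 0%N = 0)
    (x_incr : forall k : 'I_K.-1, x k < x k.+1)
    (phi_out : forall (k : 'I_K.-1) n y, ~ mesh x k y -> phi k n y = 0)
    (phi_ge0 : forall (k : 'I_K.-1) n y, mesh x k y -> 0 <= phi k n y)
    (phi_C1 : forall (k : 'I_K.-1) n, C1_on (mesh x k) (phi k n))
    (phi_indep : forall k : 'I_K.-1, lin_indep_on (mesh x k) (phi k))
    (etaP : is_eta x phi eta)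
    (alpha_diff : forall i k n (t : R), 0 <= t ->
       derivable_within (@time R) (alpha i k n) t) :
  weak_formulation T c x phi eta alpha <-> ode_system T c x phi eta alpha.
Proof.
have uM := Mmx_unit x_incr phi_C1 phi_indep.
rewrite (weak_formulation_residual eta x_incr phi_out phi_C1 T c alpha_diff).
split=> H i t t0; move: (H i t t0).
  move/eqP; rewrite /residual subr_eq0 => /eqP.
  move/(congr1 (mulmx^~ (invmx (Mmx x phi)))).
  rewrite (mulmxK uM) => /eqP; rewrite subr_eq => /eqP ->.
  by rewrite addrC -scalemxAl.
rewrite /residual => ->.
by rewrite addrAC subrr add0r -scalemxAl (mulmxKV uM) subrr.
Qed.
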